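(* A function $u:\Omega\to\mathbb{R}$ is a convex viscosity solution of the original Monge-Ampère equation $$-\det(D^2u(x))+\kappa(x)R(\nabla u(x))=0,\qquad x\in\Omega,$$ if and only if it is a viscosity solution of the convexified Monge-Ampère equation $$\max\Big\{-\prod_{j=1}^n\max\{\lambda_j(D^2u(x)),0\}+\kappa(x)R(\nabla u(x)),\,-\lambda_1(D^2u(x))\Big\}=0,\qquad x\in\Omega.$$
   Context: $\Omega\subset\mathbb{R}^n$ is a uniformly convex, bounded, open domain; $\kappa:\bar\Omega\to[0,\infty)$ is continuous and bounded; $R(p)=(1+|p|^2)^{(n+2)/2}$; $\lambda_1(X)\le\dots\le\lambda_n(X)$ are the eigenvalues of a symmetric $n\times n$ matrix $X$. No boundary condition is imposed. Original equation, with $F(x,z,p,X)=-\det(X)+\kappa(x)R(p)$: a convex upper semi-continuous $u$ is a viscosity sub-solution if for every $\phi\in C^2(\Omega)$, whenever $u-\phi$ has a local maximum at $x\in\Omega$, then $F(x,u(x),\nabla\phi(x),D^2\phi(x))\le0$. A convex lower semi-continuous $u$ is a viscosity super-solution if for every $\phi\in C^2(\Omega)$, whenever $u-\phi$ has a local minimum at $x\in\Omega$ and $D^2\phi(x)\ge0$, then $F(x,u(x),\nabla\phi(x),D^2\phi(x))\ge0$. A convex viscosity solution is a convex function that is both a sub-solution and a super-solution. Convexified equation, with $F(x,z,p,X)=\max\{-\prod_{j=1}^n\max\{\lambda_j(X),0\}+\kappa(x)R(p),-\lambda_1(X)\}$: sub-solutions (upper semi-continuous functions), super-solutions (lower semi-continuous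 functions) and viscosity solutions are defined by exactly the same test-function conditions with this $F$ (including the restriction $D^2\phi(x)\ge0$ for super-solutions), except that the functions $u$ are not required to be convex. *)

(* Defs.v *)
From HB Require Import structures.
From mathcomp Require Import all_boot all_order all_algebra.
From mathcomp Require Import all_classical all_reals all_analysis.

Set Implicit Arguments.
Unset Strict Implicit.
Unset Printing Implicit Defensive.

Import Order.TTheory GRing.Theory Num.Theory.
Import numFieldNormedType.Exports.

Local Open Scope classical_set_scope.
Local Open Scope ring_scope.

(* The norm that MathComp-Analysis puts on ['rV[R]_n] is the sup norm, which
   yields the usual topology; the Euclidean norm is needed separately. *)
Definition eucl_norm (R : realType) (n : nat) (v : 'rV[R]_n) : R :=
  Num.sqrt (\sum_(i < n) v 0 i ^+ 2).

(* Uniform convexity without boundary regularity: besides being convex, the set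
   has, at every boundary point, an enclosing sphere through that point, of a
   radius [r] independent of the point.  For a [C^2] boundary this says that
   the principal curvatures are bounded below by [1 / r]. *)
Definition uniformly_convex (R : realType) (n : nat) (Omega : set 'rV[R]_n)
    : Prop :=
  convex_set Omega /\
  exists2 r : R, 0 < r &
    forall x, (closure Omega `\` interior Omega) x ->
      exists2 c : 'rV[R]_n, eucl_norm (x - c) = r &
        forall y, Omega y -> eucl_norm (y - c) <= r.

Definition partial (R : realType) (n : nat) (i : 'I_n) (phi : 'rV[R]_n -> R)
    : 'rV[R]_n -> R :=
  'D_(delta_mx 0 i) phi.

Definition gradient (R : realType) (n : nat) (phi : 'rV[R]_n -> R)
    (x : 'rV[R]_n) : 'rV[R]_n :=
  \row_(i < n) partial i phi x.

Definition hessian (R : realType) (n : nat) (phi : 'rV[R]_n -> R)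
    (x : 'rV[R]_n) : 'M[R]_n :=
  \matrix_(i < n, j < n) partial j (partial i phi) x.

(* A function on an open set [Omega] is represented by a total function whose
   values outside [Omega] are irrelevant; this applies to test functions as well
   as to the unknown [u]. *)
Definition C2_on (R : realType) (n : nat) (Omega : set 'rV[R]_n)
    (phi : 'rV[R]_n -> R) : Prop :=
  forall x, Omega x ->
    [/\ {for x, continuous phi},
        forall i, derivable phi x (delta_mx 0 i)
                  /\ {for x, continuous (partial i phi)}
      & forall i j, derivable (partial i phi) x (delta_mx 0 j)
                  /\ {for x, continuous (partial j (partial i phi))}].

Definition psd (R : realType) (n : nat) (X : 'M[R]_n) : Prop :=
  forall v : 'rV[R]_n, 0 <= (v *m X *m v^T) 0 0.

(* The eigenvalues in nondecreasing order, repeated according to multiplicity.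
   Such a list is unique, and it exists whenever [X] is symmetric. *)
Definition eigenvalues (R : realType) (n : nat) (X : 'M[R]_n) : seq R :=
  xget [::] [set s : seq R | sorted <=%R s
                     /\ char_poly X = \prod_(a <- s) ('X - a%:P)].

(* Indexed from 0: [lambda X 0] is the smallest eigenvalue. *)
Definition lambda (R : realType) (n : nat) (X : 'M[R]_n) (j : nat) : R :=
  (eigenvalues X)`_j.

Definition lsc_on (R : realType) (n : nat) (Omega : set 'rV[R]_n)
    (u : 'rV[R]_n -> R) : Prop :=
  lower_semicontinuous (fun x : subspace Omega => (u x)%:E).

Definition usc_on (R : realType) (n : nat) (Omega : set 'rV[R]_n)
    (u : 'rV[R]_n -> R) : Prop :=
  lsc_on Omega (fun x => - u x).

Definition local_max_at (R : realType) (n : nat) (Omega : set 'rV[R]_n)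
    (f : 'rV[R]_n -> R) (x : 'rV[R]_n) : Prop :=
  \forall y \near x, Omega y -> f y <= f x.

Definition local_min_at (R : realType) (n : nat) (Omega : set 'rV[R]_n)
    (f : 'rV[R]_n -> R) (x : 'rV[R]_n) : Prop :=
  \forall y \near x, Omega y -> f x <= f y.

(* The arguments are [x], [z = u x], [p], the gradient, and [X], the Hessian. *)
Definition operator (R : realType) (n : nat) : Type :=
  'rV[R]_n -> R -> 'rV[R]_n -> 'M[R]_n -> R.

Definition viscosity_subsolution (R : realType) (n : nat) (F : operator R n)
    (Omega : set 'rV[R]_n) (u : 'rV[R]_n -> R) : Prop :=
  usc_on Omega u /\
  forall phi : 'rV[R]_n -> R, C2_on Omega phi ->
  forall x, Omega x -> local_max_at Omega (fun y => u y - phi y) x ->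
    F x (u x) (gradient phi x) (hessian phi x) <= 0.

Definition viscosity_supersolution (R : realType) (n : nat) (F : operator R n)
    (Omega : set 'rV[R]_n) (u : 'rV[R]_n -> R) : Prop :=
  lsc_on Omega u /\
  forall phi : 'rV[R]_n -> R, C2_on Omega phi ->
  forall x, Omega x -> local_min_at Omega (fun y => u y - phi y) x ->
    psd (hessian phi x) ->
    0 <= F x (u x) (gradient phi x) (hessian phi x).

Definition viscosity_solution (R : realType) (n : nat) (F : operator R n)
    (Omega : set 'rV[R]_n) (u : 'rV[R]_n -> R) : Prop :=
  viscosity_subsolution F Omega u /\ viscosity_supersolution F Omega u.

Definition convex_viscosity_solution (R : realType) (n : nat)
    (F : operator R n) (Omega : set 'rV[R]_n) (u : 'rV[R]_n -> R) : Prop :=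
  convex_function Omega u /\ viscosity_solution F Omega u.

Definition curvature_weight (R : realType) (n : nat) (p : 'rV[R]_n) : R :=
  (1 + eucl_norm p ^+ 2) `^ ((n%:R + 2) / 2).

Definition MA_operator (R : realType) (n : nat) (kappa : 'rV[R]_n -> R)
    : operator R n :=
  fun x _ p X => - \det X + kappa x * curvature_weight p.

Definition convexified_MA_operator (R : realType) (n : nat)
    (kappa : 'rV[R]_n -> R) : operator R n :=
  fun x _ p X =>
    Num.max (- (\prod_(j < n) Num.max (lambda X j) 0)
               + kappa x * curvature_weight p)
            (- lambda X 0).

(* Main.v *)
Require Import Defs.
From HB Require Import structures.
From mathcomp Require Import all_boot all_order all_algebra.
From mathcomp Require Import all_classical all_reals all_analysis.
From mathcomp Require Import sesquilinear spectral complex ring lra.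

Set Implicit Arguments.
Unset Strict Implicit.
Unset Printing Implicit Defensive.

Import Order.TTheory GRing.Theory Num.Theory.
Import numFieldNormedType.Exports.

Local Open Scope classical_set_scope.
Local Open Scope ring_scope.

(** At a symmetric matrix [X] that is positive semidefinite, all eigenvalues are
nonnegative, so the product of the [max (lambda_j, 0)] is the determinant and the
two operators differ only by the extra term [- lambda_1] inside the maximum.
For sub-solutions the extra term says precisely that [X] is positive
semidefinite ([convexified_le0]).  For super-solutions, where [X] is positive
semidefinite by assumption, it could help only when [lambda_1 = 0]; but then the
determinant vanishes and the first term is already nonnegative, because [kappa]
is ([convexified_ge0]).

So both implications reduce to the equivalence, for continuous [u], of two
properties: convexity, and positive semidefiniteness of the Hessian of every
[C^2] function touching [u] from above.
- If [u] is convex and [u - phi] has a local maximum at [x], the second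
  differences of [phi] at [x] dominate those of [u], hence are nonnegative, and
  so is the Hessian ([psd_hessian_of_touching]).
- Conversely ([segment_convexity]), suppose that [u] lies strictly above its
  chord at some point of a segment.  Compare [u], on a thin tube around the
  segment, with a quadratic polynomial that is slightly concave along the
  segment, dominates the chord there, and is very steep across it.  The
  difference is small at the two ends of the tube by continuity of [u],
  and on its side because of the steepness, while it is large at the given point
  of the segment.  Hence it has an interior maximum, where the touching
  polynomial has a Hessian that is negative in the direction of the segment.
A solution is continuous, being both upper and lower semicontinuous, which is
what the compactness argument needs.

Eigenvalues are only available for symmetric matrices.  That Hessians are
symmetric ([hessian_sym]) and that they govern second differences in all
directions ([psd_hessian_of_second_differences]) is derived from the existence
and continuity of the partial derivatives; that the spectrum of a real symmetric
matrix is real and detects positivity comes from the spectral theorem for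
Hermitian matrices over [R[i]]. *)

(** * Eigenvalues of real symmetric matrices *)

Lemma char_poly_conj (F : fieldType) (n : nat) (P A : 'M[F]_n) :
  P \in unitmx -> char_poly (invmx P *m A *m P) = char_poly A.
Proof.
move=> uP.
have mulPC (B C : 'M[F]_n) :
    map_mx polyC (B *m C) = map_mx polyC B *m map_mx polyC C.
  exact: map_mxM.
have invP : map_mx polyC (invmx P) *m map_mx polyC P = 1%:M.
  by rewrite -mulPC mulVmx // map_mx1.
rewrite /char_poly /char_poly_mx !mulPC.
rewrite -[X in X - _](_ : map_mx polyC (invmx P) *m 'X%:M *m map_mx polyC P = _);
  last by rewrite scalar_mxC -mulmxA invP mulmx1.
rewrite -mulmxBl -mulmxBr !det_mulmx mulrAC -det_mulmx invP det1 mul1r.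
by [].
Qed.

(** In the coordinates [w = v P^*] the quadratic form is the sum of the
[d_i |w_i|^2]; realness of [v] is what turns [v^T] into the adjoint of [v]. *)
Lemma unitary_diag_form_ge0 (C : numClosedFieldType) (n : nat)
    (P : 'M[C]_n) (d v : 'rV[C]_n) :
  P \is unitarymx -> (forall i, 0 <= d 0 i) -> map_mx Num.conj v = v ->
  0 <= (v *m (invmx P *m diag_mx d *m P) *m v^T) 0 0.
Proof.
move=> uP d_ge0 realv.
rewrite invmx_unitary // !mulmxA; set w := v *m _.
have -> : w *m diag_mx d *m P *m v^T
          = w *m diag_mx d *m map_mx Num.conj w^T.
  rewrite -mulmxA; congr (_ *m _).
  rewrite trmx_mul map_mxM; congr (_ *m _); last by rewrite -map_trmx realv.
  by apply/matrixP => i j; rewrite !mxE -[LHS]conjCK.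
rewrite mxE; apply: sumr_ge0 => i _.
by rewrite mul_mx_diag !mxE mulrAC mulr_ge0 // mul_conjC_ge0.
Qed.

Section symmetric_matrices.
Variables (R : realType) (n : nat) (X : 'M[R]_n).
Hypothesis symX : X^T = X.

Local Notation toC := (real_complex R).
(** A real symmetric matrix is Hermitian over [R[i]], so it is unitarily
diagonalizable with real diagonal entries. *)
Lemma symmetric_spectral_decomposition :
  exists2 P : 'M[R[i]]_n, P \is unitarymx &
    exists d : 'rV[R]_n,
      map_mx toC X = invmx P *m diag_mx (map_mx toC d) *m P.
Proof.
pose A := map_mx toC X.
have Areal : A \is a realmx.
  by apply/mxOverP => i j; rewrite mxE; apply/complex_realP; exists (X i j).
have Asym : A \is symmetricmx.
  apply/is_hermitianmxP; rewrite expr0 scale1r.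
  by apply/matrixP => i j; rewrite !mxE -[in LHS]symX mxE.
have Aherm := realsym_hermsym Asym Areal.
exists (spectralmx A); first exact: spectral_unitarymx.
exists (\row_i complex.Re (spectral_diag A 0 i)).
rewrite (_ : map_mx toC (\row_i _) = spectral_diag A).
  exact/orthomx_spectralP/hermitian_normalmx.
apply/rowP => i; rewrite !mxE RRe_real //.
exact: (mxOverP (hermitian_spectral_diag_real Aherm)).
Qed.

Lemma symmetric_char_poly_split (P : 'M[R[i]]_n) (d : 'rV[R]_n) :
  P \is unitarymx -> map_mx toC X = invmx P *m diag_mx (map_mx toC d) *m P ->
  char_poly X = \prod_(i < n) ('X - (d 0 i)%:P).
Proof.
move=> uP eX; apply: (map_poly_inj toC).
rewrite map_char_poly /= eX char_poly_conj ?unitarymx_unit //.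
rewrite char_poly_trig ?diag_mx_is_trig // rmorph_prod.
apply: eq_bigr => i _ /=.
by rewrite rmorphB /= map_polyX map_polyC /= !mxE eqxx.
Qed.

(** The characteristic polynomial splits over [R], so the list chosen in the
definition of [eigenvalues] is not the default empty one. *)
Lemma eigenvaluesP :
  sorted <=%R (eigenvalues X) /\
  char_poly X = \prod_(a <- eigenvalues X) ('X - a%:P).
Proof.
have [P uP [d eX]] := symmetric_spectral_decomposition.
apply: (@xgetPex _ [::] [set s : seq R | sorted <=%R s
                     /\ char_poly X = \prod_(a <- s) ('X - a%:P)]).
exists (sort <=%R [seq d 0 i | i <- enum 'I_n]); split.
  by apply: sort_sorted; exact: le_total.
rewrite (symmetric_char_poly_split uP eX).
rewrite (perm_big [seq d 0 i | i <- enum 'I_n]) /=; last first.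
  by rewrite perm_sort.
by rewrite big_map big_enum.
Qed.

Lemma size_eigenvalues : size (eigenvalues X) = n.
Proof.
have [_ eX] := eigenvaluesP.
have := size_char_poly X; rewrite eX size_prod_XsubC.
by move=> [].
Qed.

Lemma mem_eigenvalues (a : R) : a \in eigenvalues X = eigenvalue X a.
Proof.
by have [_ eX] := eigenvaluesP; rewrite eigenvalue_root_char eX root_prod_XsubC.
Qed.

Lemma det_lambda : \det X = \prod_(j < n) lambda X j.
Proof.
have [_ eX] := eigenvaluesP; rewrite /lambda.
move: (eigenvalues X) size_eigenvalues eX => s sn eX.
have prodN : \prod_(a <- s) - a = (-1) ^+ n * \prod_(a <- s) a.
  rewrite -sn; elim: (s) => [|a t IH]; first by rewrite !big_nil mulr1.
  by rewrite !big_cons IH /= exprS mulN1r !mulNr mulrCA.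
have : (-1) ^+ n * \det X = (-1) ^+ n * \prod_(a <- s) a.
  rewrite -char_poly_det eX -horner_coef0 horner_prod -prodN.
  by apply: eq_bigr => a _; rewrite !hornerE.
move/mulfI => -> //; last by rewrite signr_eq0.
by rewrite (big_nth 0) sn big_mkord.
Qed.

Lemma lambda0_le (a : R) : a \in eigenvalues X -> lambda X 0 <= a.
Proof.
have [sX _] := eigenvaluesP.
move=> /(nthP 0)[i ilt <-].
have := sorted_leq_nth le_trans le_refl 0 sX.
by apply; rewrite ?inE //; case: (eigenvalues X) ilt.
Qed.

Lemma psd_of_lambda0_ge0 : 0 <= lambda X 0 -> psd X.
Proof.
move=> l0 v.
have [P uP [d eX]] := symmetric_spectral_decomposition.
have d_ge0 i : 0 <= d 0 i.
  apply: (le_trans l0); apply: lambda0_le.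
  rewrite mem_eigenvalues eigenvalue_root_char.
  rewrite (symmetric_char_poly_split uP eX).
  rewrite -(big_map (fun i => d 0 i) xpredT (fun a => 'X - a%:P)).
  by rewrite root_prod_XsubC map_f // mem_index_enum.
rewrite -ler0c.
have -> : ((v *m X *m v^T) 0 0)%:C%C = (map_mx toC (v *m X *m v^T)) 0 0.
  by rewrite [RHS]mxE.
rewrite !map_mxM eX -map_trmx; apply: unitary_diag_form_ge0 => //.
  by move=> i; rewrite mxE ler0c.
by apply/rowP => i; rewrite !mxE; exact: conjc_real.
Qed.

(** Along an eigenvector [v] the quadratic form is the eigenvalue times [|v|^2];
beyond the end of the list [lambda] is [0]. *)
Lemma lambda_ge0 (j : nat) : psd X -> 0 <= lambda X j.
Proof.
move=> Xpsd; have [jn|jn] := ltnP j (size (eigenvalues X)); last first.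
  by rewrite /lambda nth_default.
have := mem_nth 0 jn; rewrite mem_eigenvalues => /eigenvalueP[v vX vN0].
have := Xpsd v; rewrite vX -scalemxAl mxE.
suff v2 : 0 < (v *m v^T) 0 0 by rewrite pmulr_lge0.
rewrite mxE; have [i vi] : exists i, v 0 i != 0.
  apply/existsP; move: vN0; apply: contraNT; rewrite negb_exists => /forallP v0.
  by apply/eqP/rowP => i; rewrite mxE; apply/eqP; have := v0 i; rewrite negbK.
rewrite (bigD1 i) //= ltr_pwDl //.
  by rewrite mxE -expr2 exprn_even_gt0.
by apply: sumr_ge0 => k _; rewrite mxE -expr2 sqr_ge0.
Qed.

Lemma lambda0_ge0P : 0 <= lambda X 0 <-> psd X.
Proof. by split; [exact: psd_of_lambda0_ge0|exact: lambda_ge0]. Qed.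

Lemma psd_prod_lambda :
  psd X -> \prod_(j < n) Num.max (lambda X j) 0 = \det X.
Proof.
move=> Xpsd; rewrite det_lambda; apply: eq_bigr => j _.
by apply/max_idPl; exact: lambda_ge0.
Qed.

End symmetric_matrices.

(** * Derivatives along lines *)

Section line_derivatives.
Variables (R : realType) (V : normedModType R).
Implicit Types (f : V -> R) (x v w : V) (d : R).

(** Turns a property of a neighbourhood into one of small displacements along
two fixed directions, which is the form used by all the mean value arguments. *)
Lemma near_plane (P : V -> Prop) x v w : (\forall y \near x, P y) ->
  exists2 r : R, 0 < r &
    forall h s, `|h| <= r -> `|s| <= r -> P (x + h *: v + s *: w).
Proof.
move=> /nbhs_normP[e /= e0 eP].
pose K : R := `|v| + `|w| + 1.
have K0 : 0 < K by rewrite ltr_wpDl // addr_ge0.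
exists (e / (2 * K)); first by rewrite divr_gt0 // mulr_gt0.
move=> h s hr sr; apply: eP => /=.
rewrite -addrA opprD addrA subrr add0r normrN.
rewrite (le_lt_trans (ler_normD _ _)) // !normrZ.
have le1 : `|h| * `|v| <= e / (2 * K) * `|v| by rewrite ler_wpM2r.
have le2 : `|s| * `|w| <= e / (2 * K) * `|w| by rewrite ler_wpM2r.
apply: (le_lt_trans (lerD le1 le2)).
rewrite -mulrDr -mulrA gtr_pMr // mulrC ltr_pdivrMr ?mulr_gt0 // mul1r /K.
have := normr_ge0 v; have := normr_ge0 w; lra.
Qed.

(** The quotient-free form of differentiability in a direction: it includes
[h = 0] and can be summed over directions. *)
Lemma is_derive_linearP f x v d :
  is_derive x v f d <->
  forall e, 0 < e -> exists2 r : R, 0 < r &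
    forall h, `|h| <= r -> `|f (x + h *: v) - f x - h * d| <= e * `|h|.
Proof.
have quot h : h != 0 ->
    `|d - h^-1 *: ((f \o shift x) (h *: v) - f x)| * `|h|
    = `|f (x + h *: v) - f x - h * d|.
  move=> h0; rewrite -normrM mulrBl /= [_ *: _]mulrC mulfVK //.
  by rewrite -normrN opprB [h *: v + x]addrC [d * h]mulrC.
split=> [[dfx dE] e e0|H].
  move: dfx; rewrite /derivable => /cvg_ex[l fl].
  have ld : l = d by rewrite -dE; apply/esym; exact: cvg_lim.
  move/cvgrPdist_le: fl => /(_ e e0); rewrite ld.
  rewrite near_withinE => /nbhs_normP[r /= r0 rP].
  exists (r / 2); first by rewrite divr_gt0.
  move=> h hr; have [->|h0] := eqVneq h 0.
    by rewrite scale0r addr0 subrr mul0r subrr normr0 mulr0.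
  rewrite -quot // ler_wpM2r //; apply: rP => //=.
  rewrite sub0r normrN (le_lt_trans hr) // ltr_pdivrMr // ltr_pMr //.
  by rewrite ltr1n.
have cv : (fun h => h^-1 *: ((f \o shift x) (h *: v) - f x)) @ 0^' --> d.
  apply/cvgrPdist_le => e e0; have [r r0 rP] := H e e0.
  rewrite near_withinE; apply/nbhs_normP; exists r => //= h /=.
  rewrite sub0r normrN => hr h0.
  by rewrite -(@ler_pM2r _ `|h|) ?normr_gt0 // quot // rP // ltW.
by split; [apply/cvg_ex; exists d|exact: cvg_lim].
Qed.

Lemma is_derive_of_expansion f x v (d k : R) :
  (forall h, f (x + h *: v) = f x + h * d + h * h * k) -> is_derive x v f d.
Proof.
move=> fE; apply/is_derive_linearP => e e0.
have K0 : 0 < `|k| + 1 by rewrite ltr_wpDl.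
exists (e / (`|k| + 1)); first by rewrite divr_gt0.
move=> h hr; rewrite fE.
rewrite [X in `|X|](_ : _ = h * h * k); last by ring.
rewrite -mulrA mulrC normrM ler_wpM2r // normrM.
rewrite ler_pdivlMr // in hr; apply: le_trans hr.
by rewrite ler_wpM2l // lerDl.
Qed.

End line_derivatives.

Lemma is_derive_mulr (R : realType) (k t : R) :
  is_derive t 1 (fun s : R => s * k) k.
Proof.
apply: (@is_derive_of_expansion _ _ _ _ _ _ 0) => h.
by rewrite [_ *: 1]mulr1; ring.
Qed.

Lemma is_derive_along_line (R : realType) (V : normedModType R) (f : V -> R)
    (x v : V) (t d : R) :
  is_derive (x + t *: v) v f d -> is_derive t 1 (fun s : R => f (x + s *: v)) d.
Proof.
move=> /is_derive_linearP fd.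
apply/is_derive_linearP => e e0; have [r r0 rP] := fd e e0.
exists r => // h hr; rewrite [_ *: 1]mulr1 scalerDl addrA; exact: rP.
Qed.

Lemma mean_value_bound (R : realType) (g dg : R -> R) (b K : R) :
  (forall s : R, `|s| <= `|b| -> is_derive s 1 g (dg s) /\ `|dg s| <= K) ->
  `|g b - g 0| <= K * `|b|.
Proof.
move=> H.
have wc (a c : R) : (forall s, s \in `[a, c] -> `|s| <= `|b|) ->
    {within `[a, c], continuous g}.
  move=> ac; apply: derivable_within_continuous => s sac.
  by have [[]] := H s (ac s sac).
have [b0|b0|->] := ltgtP b 0; last by rewrite subrr normr0 mulr0.
- have sub s : s \in `[b, 0] -> `|s| <= `|b|.
    by rewrite in_itv /= => /andP[bs s0]; rewrite !ler0_norm ?lerN2 // ltW.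
  have dg' s : s \in `]b, 0[ -> is_derive s 1 g (dg s).
    by move=> /subset_itv_oo_cc /sub /H[].
  have [s sb] := MVT b0 dg' (wc _ _ sub).
  rewrite distrC => ->; rewrite sub0r normrM normrN ler_wpM2r //.
  by move: sb => /subset_itv_oo_cc /sub /H[].
- have sub s : s \in `[0, b] -> `|s| <= `|b|.
    by rewrite in_itv /= => /andP[s0 sb]; rewrite !ger0_norm // ltW.
  have dg' s : s \in `]0, b[ -> is_derive s 1 g (dg s).
    by move=> /subset_itv_oo_cc /sub /H[].
  have [s sb ->] := MVT b0 dg' (wc _ _ sub).
  rewrite subr0 normrM ler_wpM2r //.
  by move: sb => /subset_itv_oo_cc /sub /H[].
Qed.

(** If [c] were negative, the even part [g t + g (- t)] would have derivative
[dg t - dg (- t)], close to [2 t c], hence would decrease strictly to the right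
of [0]. *)
Lemma second_derivative_ge0 (R : realType) (g dg : R -> R) (c r : R) :
  0 < r -> (forall t : R, `|t| <= r -> is_derive t 1 g (dg t)) ->
  is_derive (0 : R) 1 dg c ->
  (forall t, `|t| <= r -> 0 <= g t + g (- t) - 2 * g 0) -> 0 <= c.
Proof.
move=> r0 gd /is_derive_linearP dgd k_ge0.
rewrite leNgt; apply/negP => c0.
(* With an error of [- c / 4] on each side, [dg t - dg (- t)] stays below
   [3 / 2 * (t c)]. *)
have [r' r'0 r'P] : exists2 r' : R, 0 < r' & forall h, `|h| <= r' ->
    `|dg h - dg 0 - h * c| <= - c / 4 * `|h|.
  have c4 : 0 < - c / 4 by rewrite divr_gt0 // oppr_gt0.
  have [r' r'0 r'P] := dgd _ c4.
  by exists r' => // h /r'P; rewrite add0r [_ *: 1]mulr1.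
pose b := Num.min r r'.
have b0 : 0 < b by rewrite lt_min r0 r'0.
have leb s : s \in `[0, b] -> `|s| <= r /\ `|s| <= r'.
  rewrite in_itv /= => /andP[s0 sb]; rewrite ger0_norm //.
  by move: sb; rewrite le_min => /andP.
have kd s : s \in `[0, b] ->
    is_derive s 1 (fun t : R => g t + g (- t)) (dg s - dg (- s)).
  move=> /leb[sr _].
  have h1 := gd _ sr.
  have h2 : is_derive s 1 (fun t : R => g (- t)) (- dg (- s)).
    have /is_derive_linearP g's : is_derive (- s) 1 g (dg (- s)).
      by apply: gd; rewrite normrN.
    apply/is_derive_linearP => e e0; have [q q0 qP] := g's e e0.
    exists q => // h; rewrite -normrN => /qP.
    by rewrite ![_ *: 1]mulr1 opprD normrN mulrN mulNr.
  exact: is_deriveD.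
have wc : {within `[0, b], continuous (fun t : R => g t + g (- t))}.
  by apply: derivable_within_continuous => s /kd[].
have kd' s : s \in `]0, b[ ->
    is_derive s 1 (fun t : R => g t + g (- t)) (dg s - dg (- s)).
  by move=> /subset_itv_oo_cc /kd.
have [s sb] := MVT b0 kd' wc.
have b_in : b \in `[0, b] by rewrite in_itv /= lexx ltW.
have [br _] := leb _ b_in.
have := k_ge0 _ br.
rewrite /= oppr0 addr0 -mulr2n -mulr_natl => kb kE.
have sb' := subset_itv_oo_cc sb.
have [_ sr'] := leb _ sb'.
have s0 : 0 < s by move: sb; rewrite in_itv => /andP[].
have := r'P _ sr'.
have : `|dg (- s) - dg 0 - (- s) * c| <= - c / 4 * `|- s|.
  by apply: r'P; rewrite normrN.
rewrite normrN !ler_norml (gtr0_norm s0) => /andP[h1 h2] /andP[h3 h4].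
have : (dg s - dg (- s)) * b < 0.
  rewrite nmulr_rlt0 //.
  have : s * c < 0 by rewrite pmulr_rlt0.
  lra.
by rewrite -kE; lra.
Qed.

(** * Second derivatives from continuous partial derivatives *)

Section partial_derivatives.
Variables (R : realType) (n : nat).
Implicit Types (phi : 'rV[R]_n -> R) (x v w : 'rV[R]_n) (i j : 'I_n).

Local Notation e_ i := (delta_mx 0 i : 'rV[R]_n).

(** The increment in one coordinate is controlled uniformly in the base point
[x + h *: w], by the mean value theorem and the continuity of the partial
derivative; this uniformity is what allows coordinates to be changed one after
the other in [is_derive_partials]. *)
Lemma partial_increment phi x i w (c e : R) :
  (\forall y \near x, derivable phi y (e_ i)) ->
  {for x, continuous (partial i phi)} -> 0 < e ->
  exists2 r : R, 0 < r & forall h, `|h| <= r ->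
    `|phi (x + h *: w + (h * c) *: e_ i) - phi (x + h *: w)
      - h * c * partial i phi x| <= e * `|h|.
Proof.
move=> phid phic e0.
pose K := `|c| + 1.
have K0 : 0 < K by rewrite ltr_wpDl.
have eK : 0 < e / K by rewrite divr_gt0.
move/cvgrPdist_le: phic => /(_ _ eK) phic.
have [r r0 rP] := near_plane w (e_ i) (filterI phid phic).
exists (r / K); first by rewrite divr_gt0.
move=> h hrK; have hr : `|h| * K <= r by rewrite -ler_pdivlMr.
have hcr : `|h * c| <= r.
  by rewrite (le_trans _ hr) // normrM ler_wpM2l // lerDl.
have hr1 : `|h| <= r by rewrite (le_trans _ hr) // ler_peMr // lerDr.
pose g s := phi (x + h *: w + s *: e_ i) - s * partial i phi x.
have := @mean_value_bound _ g
  (fun s => partial i phi (x + h *: w + s *: e_ i) - partial i phi x) (h * c)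
  (e / K).
rewrite /g scale0r addr0 mul0r subr0 addrAC => H.
apply: (le_trans (H _)).
  move=> s /le_trans /(_ hcr) sr; have [/= sd sc] := rP h s hr1 sr.
  split; last by rewrite distrC.
  have dlin := is_derive_mulr (partial i phi x) s.
  apply: is_deriveB.
  by apply: is_derive_along_line; exact: derivableP.
rewrite normrM mulrCA -mulrA mulrC -mulrA ler_wpM2l //.
  exact: ltW.
rewrite mulrC -[leRHS]mulr1 ler_wpM2l //.
by rewrite mulrC ler_pdivrMr // mul1r lerDl.
Qed.

(** A function with continuous partial derivatives has derivatives in all
directions, given by the gradient. *)
Lemma is_derive_partials phi x v :
  (\forall y \near x, forall i, derivable phi y (e_ i)) ->
  (forall i, {for x, continuous (partial i phi)}) ->
  is_derive x v phi (\sum_(i < n) v 0 i * partial i phi x).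
Proof.
move=> phid phic.
have phid' i : \forall y \near x, derivable phi y (e_ i).
  by apply: filterS phid.
pose w (s : seq 'I_n) := \sum_(i <- s) v 0 i *: e_ i.
have steps (s : seq 'I_n) e : 0 < e -> exists2 r : R, 0 < r &
    forall h, `|h| <= r -> `|phi (x + h *: w s) - phi x
      - h * (\sum_(i <- s) v 0 i * partial i phi x)| <= e * `|h|.
  elim: s e => [|i s IH] e e0.
    exists 1 => // h _; rewrite /w !big_nil scaler0 addr0 subrr mulr0 subrr.
    by rewrite normr0 mulr_ge0 // ltW.
  have e20 : 0 < e / 2 by rewrite divr_gt0.
  have [r1 r10 r1P] := IH _ e20.
  have [r2 r20 r2P] := partial_increment (w s) (v 0 i) (phid' i) (phic i) e20.
  exists (Num.min r1 r2); first by rewrite lt_min r10 r20.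
  move=> h; rewrite le_min => /andP[/r1P h1 /r2P h2].
  rewrite {1}/w !big_cons -/(w s) [X in h *: X]addrC scalerDr addrA scalerA.
  have := lerD h1 h2; rewrite -mulrDl -splitr; apply: le_trans.
  apply: le_trans (ler_normD _ _); rewrite le_eqVlt; apply/orP; left.
  apply/eqP; congr (`|_|); ring.
apply/is_derive_linearP => e e0.
have := steps (index_enum 'I_n) e e0.
by rewrite /w -row_sum_delta.
Qed.

End partial_derivatives.

Section second_derivatives.
Variables (R : realType) (n : nat) (Omega : set 'rV[R]_n).
Hypothesis Omega_open : open Omega.
Variable phi : 'rV[R]_n -> R.
Hypothesis phiC2 : C2_on Omega phi.
Variable x : 'rV[R]_n.
Hypothesis Omega_x : Omega x.
Implicit Types (v : 'rV[R]_n) (i j : 'I_n).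

Local Notation e_ i := (delta_mx 0 i : 'rV[R]_n).

Let near_Omega : \forall y \near x, Omega y.
Proof. exact: open_nbhs_nbhs. Qed.

(** On the line through [x] directed by [v], the first derivative of [phi] is a
combination of partial derivatives, to which [is_derive_partials] applies again:
the second derivative at [x] is the quadratic form of the Hessian. *)
Lemma psd_hessian_of_second_differences :
  (forall v, \forall t \near (0 : R),
     0 <= phi (x + t *: v) + phi (x - t *: v) - 2 * phi x) ->
  psd (hessian phi x).
Proof.
move=> H v.
have [r r0 rP] := near_plane v 0 near_Omega.
have inO t : `|t| <= r -> Omega (x + t *: v).
  by move=> tr; have := rP t 0 tr; rewrite scaler0 addr0 normr0; apply; apply: ltW.
have /nbhs_normP[r' /= r'0 r'P] := H v.
pose b := Num.min r (r' / 2).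
apply: (@second_derivative_ge0 _ (fun t => phi (x + t *: v))
  (fun t => \sum_(i < n) v 0 i * partial i phi (x + t *: v)) _ b).
- by rewrite lt_min r0 divr_gt0.
- move=> t; rewrite le_min => /andP[tr _].
  apply: is_derive_along_line; apply: is_derive_partials.
    have := open_nbhs_nbhs (conj Omega_open (inO t tr)).
    by apply: filterS => y /phiC2[_ H1 _] i; have [] := H1 i.
  by move=> i; have [_ H1 _] := phiC2 (inO t tr); have [] := H1 i.
- rewrite -[_ 0 0](_ : \sum_(i < n) v 0 i *
      (\sum_(j < n) v 0 j * partial j (partial i phi) x) = _); last first.
    rewrite mxE; under [RHS]eq_bigr do rewrite !mxE mulr_suml.
    rewrite [RHS]exchange_big /=; apply: eq_bigr => i _.
    rewrite mulr_sumr; apply: eq_bigr => j _; rewrite !mxE.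
    by rewrite -!mulrA; congr (_ * _); rewrite mulrC.
  apply: (@is_derive_along_line _ _
    (fun y => \sum_(i < n) v 0 i * partial i phi y)).
  rewrite scale0r addr0.
  have -> : (fun y => \sum_(i < n) v 0 i * partial i phi y) =
      \sum_(i < n) (fun y => v 0 i * partial i phi y).
    by apply/funext => y; rewrite fct_sumE.
  apply: is_derive_sum => i.
  apply: is_deriveZ; apply: is_derive_partials.
    by apply: filterS near_Omega => y /phiC2[_ _ H2] j; have [] := H2 i j.
  by move=> j; have [_ _ H2] := phiC2 Omega_x; have [] := H2 i j.
- move=> t; rewrite le_min => /andP[_ tr].
  rewrite scaleNr scale0r addr0; apply: r'P => /=.
  by rewrite sub0r normrN (le_lt_trans tr) // ltr_pdivrMr // ltr_pMr // ltr1n.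
Qed.

(** The second increment over a small square, divided by [h^2], tends to the
mixed derivative; it is symmetric in [i] and [j], whence [hessian_sym]. *)
Lemma second_increment i j (e : R) : 0 < e -> exists2 r : R, 0 < r &
  forall h, `|h| <= r ->
  `|phi (x + h *: e_ i + h *: e_ j) - phi (x + h *: e_ i)
    - phi (x + h *: e_ j) + phi x - h * h * partial j (partial i phi) x|
  <= e * `|h| * `|h|.
Proof.
move=> e0.
have [_ _ /(_ i j)[_]] := phiC2 Omega_x.
move=> /cvgrPdist_le /(_ _ e0) near_c.
have [r r0 rP] := near_plane (e_ i) (e_ j) (filterI near_Omega near_c).
exists r => // h hr.
set a := partial j (partial i phi) x.
pose g s := phi (x + s *: e_ i + h *: e_ j) - phi (x + s *: e_ i) - s * (h * a).
pose dg s := partial i phi (x + s *: e_ i + h *: e_ j)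
             - partial i phi (x + s *: e_ i) - h * a.
have := @mean_value_bound _ g dg h (e * `|h|).
rewrite /g !scale0r !addr0 !mul0r subr0 => H.
rewrite [X in `|X|](_ : _ = phi (x + h *: e_ i + h *: e_ j)
    - phi (x + h *: e_ i) - h * (h * a) - (phi (x + h *: e_ j) - phi x));
  last by ring.
apply: H => s /le_trans /(_ hr) sr.
have h0r : `|0 : R| <= r by rewrite normr0 ltW.
split.
  have dlin := is_derive_mulr (h * a) s.
  apply: is_deriveB.
  apply: is_deriveB.
    have -> : (fun s => phi (x + s *: e_ i + h *: e_ j)) =
        (fun s => phi ((x + h *: e_ j) + s *: e_ i)).
      by apply/funext => t; rewrite addrAC.
    apply: is_derive_along_line; rewrite (addrAC x (h *: _)).
    have [/phiC2[_ /(_ i)[H1 _] _] _] := rP s h sr hr.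
    exact: derivableP.
  apply: is_derive_along_line; apply: derivableP.
  have [/phiC2[_ /(_ i)[H1 _] _] _] := rP s 0 sr h0r.
  by move: H1; rewrite scale0r addr0.
rewrite /dg.
have := @mean_value_bound _
  (fun t => partial i phi (x + s *: e_ i + t *: e_ j) - t * a)
  (fun t => partial j (partial i phi) (x + s *: e_ i + t *: e_ j) - a) h e.
rewrite scale0r addr0 mul0r subr0 addrAC; apply=> t /le_trans /(_ hr) tr.
have [/phiC2[_ _ /(_ i j)[H1 _]] H2] := rP s t sr tr.
split; last by rewrite distrC.
have dlin := is_derive_mulr a t.
apply: is_deriveB.
by apply: is_derive_along_line; exact: derivableP.
Qed.

Lemma hessian_sym : (hessian phi x)^T = hessian phi x.
Proof.
apply/matrixP => i j; rewrite !mxE.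
set a := partial i _ x; set b := partial j _ x.
apply/eqP; rewrite -subr_eq0 -normr_le0; apply/ler_addgt0Pl => e e0.
rewrite addr0.
have e20 : 0 < e / 2 by rewrite divr_gt0.
have [r1 r10 r1P] := second_increment i j e20.
have [r2 r20 r2P] := second_increment j i e20.
pose h := Num.min r1 r2.
have h0 : 0 < h by rewrite lt_min r10 r20.
have h1 : `|h| <= r1 by rewrite gtr0_norm // ge_min lexx.
have h2 : `|h| <= r2 by rewrite gtr0_norm // ge_min lexx orbT.
have := r1P _ h1; have := r2P _ h2.
rewrite -/a -/b (addrAC x) => H2 H1.
rewrite -(@ler_pM2r _ (h * h)) ?mulr_gt0 //.
rewrite -[X in `|a - b| * X]gtr0_norm ?mulr_gt0 // -normrM.
have := lerD H1 H2; rewrite (gtr0_norm h0).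
have -> : e / 2 * h * h + e / 2 * h * h = e * (h * h) by field.
apply: le_trans; apply: le_trans (ler_normB _ _).
rewrite le_eqVlt; apply/orP; left; apply/eqP; congr (`|_|); ring.
Qed.

End second_derivatives.

(** * Quadratic functions *)

Lemma continuous_sum (R : realType) (T : topologicalType) (I : finType)
    (f : I -> T -> R) (x : T) :
  (forall i, {for x, continuous (f i)}) ->
  {for x, continuous (fun y => \sum_i f i y)}.
Proof.
move=> fc.
have -> : (fun y => \sum_i f i y) = \sum_i f i.
  by apply/funext => y; rewrite fct_sumE.
elim/big_ind: _ => [|g h gc hc|i _]; [exact: cst_continuous|exact: continuousD|].
exact: fc.
Qed.

Section quadratic_functions.
Variables (R : realType) (n : nat).
Implicit Types (p v w x y : 'rV[R]_n) (G : 'M[R]_n).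

Definition dot v w : R := (v *m w^T) 0 0.

(** [G] need not be symmetric: the Hessian is [G + G^T]. *)
Definition quadratic (c : R) (b : 'rV[R]_n) G p y : R :=
  c + dot (y - p) b + dot ((y - p) *m G) (y - p).

Lemma dotDl v w x : dot (v + w) x = dot v x + dot w x.
Proof. by rewrite /dot mulmxDl mxE. Qed.

Lemma dotZl (k : R) v w : dot (k *: v) w = k * dot v w.
Proof. by rewrite /dot -scalemxAl mxE. Qed.

Lemma dotC v w : dot v w = dot w v.
Proof. by rewrite /dot -[RHS]trace_mx11 -mxtrace_tr trmx_mul trmxK trace_mx11. Qed.

Lemma dotDr v w x : dot v (w + x) = dot v w + dot v x.
Proof. by rewrite dotC dotDl !(dotC v). Qed.

Lemma dotZr (k : R) v w : dot v (k *: w) = k * dot v w.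
Proof. by rewrite dotC dotZl dotC. Qed.

Lemma dot_sum v w : dot v w = \sum_(i < n) v 0 i * w 0 i.
Proof. by rewrite /dot mxE; apply: eq_bigr => i _; rewrite mxE. Qed.

Lemma dot_ge0 v : 0 <= dot v v.
Proof. by rewrite dot_sum sumr_ge0 // => i _; rewrite -expr2 sqr_ge0. Qed.

Lemma dot_gt0 v : v != 0 -> 0 < dot v v.
Proof.
move=> v0; rewrite lt_neqAle dot_ge0 andbT eq_sym; apply: contra_neq v0.
rewrite dot_sum => /eqP; rewrite psumr_eq0; last first.
  by move=> i _; rewrite -expr2 sqr_ge0.
move=> /allP v0; apply/rowP => i; rewrite mxE; apply/eqP.
by have := v0 i (mem_index_enum i); rewrite mulf_eq0 orbb.
Qed.

(** The norm on row vectors is the sup norm, which the Euclidean one dominates. *)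
Lemma normr_le_dot v (d : R) : 0 <= d -> dot v v <= d ^+ 2 -> `|v| <= d.
Proof.
move=> d0 vd; rewrite [leLHS]mx_normrE.
apply/bigmax_leP; split=> // -[i j] _ /=; rewrite (ord1 i).
rewrite -(@ler_pXn2r _ 2) ?nnegrE // real_normK ?num_real //.
apply: le_trans vd; rewrite dot_sum (bigD1 j) //= expr2 lerDl sumr_ge0 // => k _.
by rewrite -expr2 sqr_ge0.
Qed.

Lemma partial_quadratic c b G p i y :
  is_derive y (delta_mx 0 i) (quadratic c b G p)
    (dot (delta_mx 0 i) b + dot (delta_mx 0 i *m G) (y - p)
     + dot ((y - p) *m G) (delta_mx 0 i)).
Proof.
set v := delta_mx 0 i.
apply: (@is_derive_of_expansion _ _ _ _ _ _ (dot (v *m G) v)) => h.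
rewrite /quadratic (addrAC y) mulmxDl -scalemxAl !(dotDl, dotDr) !(dotZl, dotZr).
ring.
Qed.

Lemma partialE c b G p i :
  partial i (quadratic c b G p) = fun y =>
    dot (delta_mx 0 i) b + dot (delta_mx 0 i *m G) (y - p)
     + dot ((y - p) *m G) (delta_mx 0 i).
Proof.
by apply/funext => y; have [_ H] := partial_quadratic c b G p i y.
Qed.

Lemma partial2_quadratic c b G p i j y :
  is_derive y (delta_mx 0 j) (partial i (quadratic c b G p)) ((G + G^T) i j).
Proof.
rewrite partialE.
apply: (@is_derive_of_expansion _ _ _ _ _ _ 0) => h.
set v := delta_mx 0 j; set w := delta_mx 0 i.
have -> : (G + G^T) i j = dot (w *m G) v + dot (v *m G) w.
  by rewrite /dot -!rowE !trmx_delta -!colE !mxE.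
rewrite (addrAC y) mulmxDl -scalemxAl !(dotDl, dotDr) !(dotZl, dotZr).
ring.
Qed.

Lemma hessian_quadratic c b G p y : hessian (quadratic c b G p) y = G + G^T.
Proof.
apply/matrixP => i j.
by rewrite mxE; have [_ H] := partial2_quadratic c b G p i j y; exact: H.
Qed.

Lemma continuous_dot (f g : 'rV[R]_n -> 'rV[R]_n) :
  (forall i, continuous (fun y => f y 0 i)) ->
  (forall i, continuous (fun y => g y 0 i)) ->
  continuous (fun y => dot (f y) (g y)).
Proof.
move=> fc gc y; under eq_fun do rewrite dot_sum.
apply: continuous_sum => i.
by apply: continuousM; [exact: fc|exact: gc].
Qed.

Lemma continuous_subr_coord p i : continuous (fun y : 'rV[R]_n => (y - p) 0 i).
Proof.
under eq_fun do rewrite !mxE.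
move=> y; apply: continuousB; [exact: coord_continuous|exact: cst_continuous].
Qed.

Lemma continuous_mulmx_coord p m (G : 'M[R]_(n, m)) i :
  continuous (fun y : 'rV[R]_n => ((y - p) *m G) 0 i).
Proof.
under eq_fun do rewrite mxE.
move=> y; apply: continuous_sum => k.
apply: continuousM; [exact: continuous_subr_coord|exact: cst_continuous].
Qed.

Lemma continuous_quadratic c b G p : continuous (quadratic c b G p).
Proof.
have lin : continuous (fun y => dot (y - p) b).
  by apply: continuous_dot => i; [exact: continuous_subr_coord|
    exact: cst_continuous].
have quad : continuous (fun y => dot ((y - p) *m G) (y - p)).
  by apply: continuous_dot => i; [exact: continuous_mulmx_coord|
    exact: continuous_subr_coord].
move=> y; exact: cvgD (cvgD (cvg_cst c) (lin y)) (quad y).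
Qed.

Lemma C2_quadratic (Omega : set 'rV[R]_n) c b G p :
  C2_on Omega (quadratic c b G p).
Proof.
move=> x _; split; first exact: continuous_quadratic.
- move=> i; split; first by have [] := partial_quadratic c b G p i x.
  pose v : 'rV[R]_n := delta_mx 0 i.
  have left_lin : continuous (fun y => dot (v *m G) (y - p)).
    by apply: continuous_dot => k; [exact: cst_continuous|
      exact: continuous_subr_coord].
  have right_lin : continuous (fun y => dot ((y - p) *m G) v).
    by apply: continuous_dot => k; [exact: continuous_mulmx_coord|
      exact: cst_continuous].
  rewrite partialE.
  exact: cvgD (cvgD (cvg_cst (dot v b)) (left_lin x)) (right_lin x).
- move=> i j; split; first by have [] := partial2_quadratic c b G p i j x.
  have -> : partial j (partial i (quadratic c b G p)) = cst ((G + G^T) i j).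
    by apply/funext => y; have [_ H] := partial2_quadratic c b G p i j y.
  exact: cst_continuous.
Qed.

End quadratic_functions.

(** * Convexity and functions touching from above *)

Section convexity.
Variables (R : realType) (n : nat) (Omega : set 'rV[R]_n).
Hypothesis Omega_open : open Omega.
Variable u : 'rV[R]_n -> R.
Implicit Types (p e x y z : 'rV[R]_n).

Lemma dot_gram m (A : 'M[R]_(n, m)) z :
  dot (z *m (A *m A^T)) z = dot (z *m A) (z *m A).
Proof. by rewrite /dot trmx_mul !mulmxA. Qed.

(** With [u x] below the average of [u (x + t v)] and [u (x - t v)], and
[phi - phi x] above [u - u x] near [x], the second difference of [phi] is
nonnegative. *)
Lemma psd_hessian_of_touching (phi : 'rV[R]_n -> R) x :
  (forall p e t, Omega p -> Omega (p + e) -> 0 <= t <= 1 ->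
     u (p + t *: e) <= u p + t * (u (p + e) - u p)) ->
  C2_on Omega phi -> Omega x ->
  local_max_at Omega (fun y => u y - phi y) x -> psd (hessian phi x).
Proof.
move=> u_convex phiC2 Ox umax.
apply: (psd_hessian_of_second_differences Omega_open phiC2 Ox) => v.
have nearO : \forall y \near x, Omega y by exact: open_nbhs_nbhs.
have [r r0 rP] := near_plane v 0 (filterI nearO umax).
have le0r : `|0 : R| <= r by rewrite normr0 ltW.
apply/nbhs_normP; exists r => //= t /=; rewrite sub0r normrN => /ltW tr.
have [] := rP t 0 tr le0r; rewrite scaler0 addr0 => O1 /(_ O1) h1.
have ntr : `|- t| <= r by rewrite normrN.
have [] := rP (- t) 0 ntr le0r; rewrite scaler0 addr0 scaleNr => O2 /(_ O2) h2.
have half01 : 0 <= (2^-1 : R) <= 1.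
  by rewrite invr_ge0 ler0n invf_le1 ?ler1n.
have := u_convex (x - t *: v) (2 * t *: v) 2^-1 O2.
have -> : x - t *: v + 2 * t *: v = x + t *: v.
  by rewrite -addrA -scaleNr -scalerDl; congr (_ + _ *: _); ring.
have -> : x - t *: v + 2^-1 *: (2 * t *: v) = x.
  by rewrite scalerA mulrA mulVf ?pnatr_eq0 // mul1r subrK.
move=> /(_ O1 half01); lra.
Qed.

Section tube.
Variables p e : 'rV[R]_n.
Hypothesis e0 : e != 0.

Let b := (dot e e)^-1 *: e.
(** Coordinates adapted to the segment from [p] to [p + e]: [axial] runs from [0]
to [1] along it, and [transverse] is the part of [y - p] orthogonal to [e]. *)
Definition axial y := dot (y - p) b.
Definition transverse_mx : 'M[R]_n := 1%:M - b^T *m e.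
Definition transverse y := (y - p) *m transverse_mx.
Definition axis_dist2 y := dot (transverse y) (transverse y).

Lemma dot_direction : dot e b = 1.
Proof. by rewrite /b dotZr mulVf // gt_eqF // dot_gt0. Qed.

Lemma transverseE y : transverse y = y - p - axial y *: e.
Proof.
rewrite /transverse /transverse_mx mulmxBr mulmx1; congr (_ - _).
rewrite mulmxA [X in X *m e]mx11_scalar mul_scalar_mx.
by rewrite /axial /dot.
Qed.

Lemma direction_transverse : e *m transverse_mx = 0.
Proof.
have := transverseE (p + e); rewrite /transverse /axial (addrC p) addrK.
by rewrite dot_direction scale1r subrr.
Qed.

Lemma transverse_decomposition y : y = p + transverse y + axial y *: e.
Proof. by rewrite transverseE -addrA subrK addrC subrK. Qed.

(** The polynomial [u0 + (u1 - u0) s + D s (1 - s) + M q], where [s] is [axial]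
and [q] is [axis_dist2] (see [barrierE]): the chord between the values [u0] and
[u1], raised by a concave bump and steep across the segment.  It is written as a
[quadratic] so that its Hessian is known. *)
Definition barrier (u0 u1 D M : R) : 'rV[R]_n -> R :=
  quadratic u0 ((u1 - u0 + D) *: b)
    (M *: (transverse_mx *m transverse_mx^T) - D *: (b^T *m b^T^T)) p.

Lemma dot_barrier_mx (M D : R) z :
  dot (z *m (M *: (transverse_mx *m transverse_mx^T) - D *: (b^T *m b^T^T))) z
  = M * dot (z *m transverse_mx) (z *m transverse_mx) - D * dot z b ^+ 2.
Proof.
rewrite mulmxBr -!scalemxAr -scaleNr dotDl !dotZl !dot_gram mulNr.
congr (_ - D * _).
by rewrite dot_sum big_ord1 expr2.
Qed.

Lemma barrierE (u0 u1 D M : R) y :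
  barrier u0 u1 D M y = u0 + (u1 - u0) * axial y
    + D * (axial y * (1 - axial y)) + M * axis_dist2 y.
Proof.
rewrite /barrier /quadratic dot_barrier_mx dotZr -/(axial y).
by rewrite /axis_dist2 /transverse; ring.
Qed.

(** In the direction [e] of the segment the form of the Hessian is [- 2 D]. *)
Lemma barrier_not_psd (u0 u1 D M : R) y :
  0 < D -> ~ psd (hessian (barrier u0 u1 D M) y).
Proof.
move=> D0 /(_ e); rewrite hessian_quadratic -/(dot _ _) mulmxDr dotDl.
set G := (X in dot (e *m X) e + _).
have -> : dot (e *m G^T) e = dot (e *m G) e.
  by rewrite dotC /dot trmx_mul trmxK mulmxA.
rewrite dot_barrier_mx direction_transverse dot_direction.
have -> : dot (0 : 'rV[R]_n) 0 = 0 by rewrite /dot mul0mx mxE.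
by lra.
Qed.

Lemma continuous_axial : continuous axial.
Proof.
by apply: continuous_dot => i; [exact: continuous_subr_coord|
  exact: cst_continuous].
Qed.

Lemma continuous_axis_dist2 : continuous axis_dist2.
Proof. by apply: continuous_dot => i; exact: continuous_mulmx_coord. Qed.

Definition tube (d : R) : set 'rV[R]_n :=
  [set y | 0 <= axial y <= 1 /\ axis_dist2 y <= d ^+ 2].

Lemma transverse_le (d : R) y : 0 <= d -> tube d y -> `|transverse y| <= d.
Proof. by move=> d0 [_]; exact: normr_le_dot. Qed.

Lemma compact_tube (d : R) : 0 <= d -> compact (tube d).
Proof.
move=> d0; apply: bounded_closed_compact.
  exists (`|p| + d + `|e|); split; first exact: num_real.
  move=> k /ltW kK y yd; apply: le_trans kK.
  rewrite [y in `|y|]transverse_decomposition.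
  rewrite (le_trans (ler_normD _ _)) // lerD //.
    by rewrite (le_trans (ler_normD _ _)) // lerD // transverse_le.
  have [/andP[s0 s1] _] := yd.
  by rewrite normrZ ger0_norm // ler_piMl.
have -> : tube d = (axial @^-1` [set s | 0 <= s] `&` axial @^-1` [set s | s <= 1]) `&`
    axis_dist2 @^-1` [set q | q <= d ^+ 2].
  apply/seteqP; split => y; rewrite /tube /=.
    by move=> [/andP[]].
  by move=> [[-> ->]].
apply: closedI; first apply: closedI.
- apply: closed_comp (@closed_ge R 0) => y _; exact: continuous_axial.
- apply: closed_comp (@closed_le R 1) => y _; exact: continuous_axial.
- apply: closed_comp (@closed_le R (d ^+ 2)) => y _.
  exact: continuous_axis_dist2.
Qed.

Lemma near_tube (d : R) y : 0 < axial y < 1 -> axis_dist2 y < d ^+ 2 ->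
  \forall z \near y, tube d z.
Proof.
move=> /andP[s0 s1] qd.
have h1 := cvgr_gt _ (continuous_axial (x := y)) _ s0.
have h2 := cvgr_lt _ (continuous_axial (x := y)) _ s1.
have h3 := cvgr_lt _ (continuous_axis_dist2 (x := y)) _ qd.
near=> z; split; last by apply: ltW; near: z; exact: h3.
by apply/andP; split; apply: ltW; near: z; [exact: h1|exact: h2].
Unshelve. all: by end_near. Qed.

Hypothesis Omega_convex : forall p e t, Omega p -> Omega (p + e) ->
  0 <= t <= 1 -> Omega (p + t *: e).
Hypothesis u_continuous : forall x, Omega x -> {for x, continuous u}.
Hypothesis psd_touching : forall (phi : 'rV[R]_n -> R) x, C2_on Omega phi ->
  Omega x -> local_max_at Omega (fun y => u y - phi y) x -> psd (hessian phi x).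

(** The maximum of [u - barrier] over a thin tube is at least [3/4 D], where [D]
is the height of [u] above its chord, whereas it is at most [D / 2] on the two
ends of the tube and at most [0] on its side.  So it is attained in the interior,
where [barrier] touches [u] from above, contradicting [barrier_not_psd]. *)
Lemma segment_convexity t : Omega p -> Omega (p + e) -> 0 <= t <= 1 ->
  u (p + t *: e) <= u p + t * (u (p + e) - u p).
Proof.
move=> Op Ope t01; set u0 := u p; set u1 := u (p + e).
rewrite leNgt; apply/negP => gap.
pose D := u (p + t *: e) - (u0 + t * (u1 - u0)).
have D0 : 0 < D by rewrite subr_gt0.
(* [d] is so small that, within distance [d] of either end of the segment, [u]
   exceeds its value at that end by at most [D / 2] and [Omega] is not left; by
   convexity the whole tube then lies in [Omega]. *)
have near_end q : Omega q -> \forall y \near q, Omega y /\ u y <= u q + D / 2.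
  move=> Oq; have h1 : \forall y \near q, Omega y by exact: open_nbhs_nbhs.
  have h2 : \forall y \near q, u y < u q + D / 2.
    by apply: (cvgr_lt _ (u_continuous Oq)); rewrite ltrDl divr_gt0.
  near=> y; split; first by near: y; exact: h1.
  by apply: ltW; near: y; exact: h2.
have /nbhs_normP[d0 /= d00 d0P] := near_end _ Op.
have /nbhs_normP[d1 /= d10 d1P] := near_end _ Ope.
pose d := Num.min d0 d1 / 2.
have dm0 : 0 < Num.min d0 d1 by rewrite lt_min d00.
have d_gt0 : 0 < d by rewrite divr_gt0.
have d_ge0 := ltW d_gt0.
have [dd0 dd1] : d < d0 /\ d < d1.
  have : d < Num.min d0 d1 by rewrite ltr_pdivrMr // ltr_pMr // ltr1n.
  by rewrite lt_min => /andP.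
have near0 z : `|z| <= d -> Omega (p + z) /\ u (p + z) <= u0 + D / 2.
  move=> zd; apply: d0P => /=.
  by rewrite opprD addrA subrr sub0r normrN (le_lt_trans zd).
have near1 z : `|z| <= d -> Omega (p + e + z) /\ u (p + e + z) <= u1 + D / 2.
  move=> zd; apply: d1P => /=.
  by rewrite opprD addrA subrr sub0r normrN (le_lt_trans zd).
have tubeO : tube d `<=` Omega.
  move=> y yd; have [s01 _] := yd; rewrite (transverse_decomposition y).
  have tr := transverse_le d_ge0 yd.
  apply: Omega_convex => //; first by have [] := near0 _ tr.
  by rewrite addrAC; have [] := near1 _ tr.
have ct := compact_tube d_ge0.
have axial_t : axial (p + t *: e) = t.
  by rewrite /axial addrC addKr dotZl dot_direction mulr1.
have dist_t : axis_dist2 (p + t *: e) = 0.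
  rewrite /axis_dist2 /transverse addrC addKr -scalemxAl direction_transverse.
  by rewrite scaler0 /dot mul0mx mxE.
have tube_t : tube d (p + t *: e).
  by split; rewrite ?axial_t // dist_t sqr_ge0.
have tube0 : tube d !=set0 by exists (p + t *: e).
have uc : {within tube d, continuous u}.
  apply: continuous_in_subspaceT => y /set_mem/tubeO; exact: u_continuous.
have [c0 _ c0P] := EVT_max_rV tube0 ct uc.
(* Steep enough to absorb, at distance [d] from the axis, an upper bound of [u]
   on the tube and a lower bound of the chord. *)
pose M := (`|u c0| + `|u0| + `|u1|) / d ^+ 2.
have M0 : 0 <= M by rewrite divr_ge0 ?sqr_ge0 // !addr_ge0.
pose phi := barrier u0 u1 D M.
have phiC2 O : C2_on O phi by exact: C2_quadratic.
have phic : continuous phi by exact: continuous_quadratic.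
have wc : {within tube d, continuous (fun y => u y - phi y)}.
  apply: continuous_in_subspaceT => y /set_mem/tubeO Oy.
  exact: cvgB (u_continuous Oy) (@phic y).
have [c /set_mem ctube cmax] := EVT_max_rV tube0 ct wc.
have [/andP[s0 s1] qc] := ctube.
have tr := transverse_le d_ge0 ctube.
(* The bump costs at most a quarter of [D], since [t (1 - t) <= 1/4]. *)
have high : 3 / 4 * D <= u c - phi c.
  apply: le_trans (cmax _ (mem_set tube_t)).
  rewrite /phi barrierE axial_t dist_t.
  have -> : u (p + t *: e) = D + (u0 + t * (u1 - u0)) by rewrite subrK.
  have : D * (t * (1 - t)) <= D * (1 / 4).
    rewrite ler_pM2l //; have := sqr_ge0 (t - 1 / 2); rewrite expr2; lra.
  lra.
have q0 : 0 <= axis_dist2 c by exact: dot_ge0.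
have Mq0 : 0 <= M * axis_dist2 c by rewrite mulr_ge0.
have s0' : 0 < axial c.
  rewrite lt_neqAle s0 andbT; apply/eqP => sc.
  have [_] := near0 _ tr; move: high.
  rewrite {1}(transverse_decomposition c) /phi barrierE -sc scale0r addr0.
  lra.
have s1' : axial c < 1.
  rewrite lt_neqAle s1 andbT; apply/eqP => sc.
  have [_] := near1 _ tr; move: high.
  rewrite {1}(transverse_decomposition c) /phi barrierE sc scale1r addrAC.
  lra.
have q1' : axis_dist2 c < d ^+ 2.
  rewrite lt_neqAle qc andbT; apply/eqP => qd; move: high.
  rewrite /phi barrierE qd /M mulfVK ?expf_neq0 ?gt_eqF //.
  have := c0P _ (mem_set ctube); have := ler_norm (u c0).
  have : - (`|u0| + `|u1|) <= u0 + (u1 - u0) * axial c.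
    have h0 : - `|u0| <= u0 by rewrite lerNl -normrN ler_norm.
    have h1 : - `|u1| <= u1 by rewrite lerNl -normrN ler_norm.
    have := normr_ge0 u0; have := normr_ge0 u1; nra.
  have : 0 <= D * (axial c * (1 - axial c)).
    by rewrite mulr_ge0 ?mulr_ge0 ?subr_ge0 // ltW.
  lra.
apply: (@barrier_not_psd u0 u1 D M c D0); apply: psd_touching => //.
  exact: tubeO.
have : \forall y \near c, tube d y by apply: near_tube => //; apply/andP.
by apply: filterS => y /mem_set /cmax cy _.
Unshelve. all: by end_near. Qed.

End tube.
End convexity.

(** * The two Monge-Ampere operators *)

Lemma conv_segment (R : realType) (V : lmodType R) (t : {i01 R}) (x y : V) :
  conv t (x : convex_lmodType V) y = y + t%:num *: (x - y).
Proof.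
have -> : conv t (x : convex_lmodType V) y = t%:num *: x + (1 - t%:num) *: y.
  by [].
by rewrite scalerBl scale1r scalerBr addrCA addrA.
Qed.

(** Convexity in terms of an origin and a displacement, as [segment_convexity]
states it. *)
Lemma convex_functionP (R : realType) (n : nat) (Omega : set 'rV[R]_n)
    (u : 'rV[R]_n -> R) :
  convex_function Omega u <->
  forall p e t, Omega p -> Omega (p + e) -> 0 <= t <= 1 ->
    u (p + t *: e) <= u p + t * (u (p + e) - u p).
Proof.
split=> [uc p e t Op Ope /andP[t0 t1]|uc t x y /set_mem Ox /set_mem Oy].
  have := uc (Itv01 t0 t1) (p + e) p (mem_set Ope) (mem_set Op).
  rewrite conv_segment [X in _ <= X](@conv_segment _ R^o).
  by have -> : p + e - p = e by rewrite addrC addKr.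
rewrite conv_segment [X in _ <= X](@conv_segment _ R^o).
have xE : y + (x - y) = x by rewrite addrC subrK.
have := uc y (x - y) t%:num Oy; rewrite xE; apply=> //.
by apply/andP; split.
Qed.

Lemma convex_set_segment (R : realType) (n : nat) (Omega : set 'rV[R]_n) p e t :
  convex_set Omega -> Omega p -> Omega (p + e) -> 0 <= t <= 1 ->
  Omega (p + t *: e).
Proof.
move=> Oc Op Ope /andP[t0 t1].
have := Oc _ _ (Itv01 t0 t1) (mem_set Ope) (mem_set Op).
rewrite inE conv_segment.
by have -> : p + e - p = e by rewrite addrC addKr.
Qed.

Lemma semicontinuous_continuous (R : realType) (n : nat)
    (Omega : set 'rV[R]_n) (u : 'rV[R]_n -> R) (x : 'rV[R]_n) :
  open Omega -> usc_on Omega u -> lsc_on Omega u -> Omega x ->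
  {for x, continuous u}.
Proof.
move=> Oo usc lsc Ox.
have nearO : \forall y \near x, Omega y by exact: open_nbhs_nbhs.
have sub (V : set 'rV[R]_n) : nbhs (x : subspace Omega) V ->
    \forall y \near x, V y.
  move=> xV; have {}xV : within Omega (nbhs x) V by rewrite nbhs_subspace_in.
  by near=> y; have : Omega y -> V y; [near: y|apply; near: y].
apply/(@cvgrPdist_lt _ _ _ (nbhs x)) => e e0.
have [|V /sub xV VP] := usc x (- u x - e); first by rewrite lte_fin gtrBl.
have [|W /sub xW WP] := lsc x (u x - e); first by rewrite lte_fin gtrBl.
near=> y.
have /VP h1 : V y by near: y.
have /WP h2 : W y by near: y.
rewrite !lte_fin in h1 h2; rewrite ltr_norml; apply/andP; split; lra.
Unshelve. all: by end_near. Qed.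

Section equivalence.
Variables (R : realType) (n : nat) (kappa : 'rV[R]_n -> R).
Implicit Types (x p : 'rV[R]_n) (z : R) (X : 'M[R]_n).

Lemma curvature_weight_ge0 p : 0 <= curvature_weight p.
Proof. exact: powR_ge0. Qed.

Lemma convexified_le0 x z p X : X^T = X ->
  convexified_MA_operator kappa x z p X <= 0
  <-> psd X /\ MA_operator kappa x z p X <= 0.
Proof.
move=> symX; rewrite /convexified_MA_operator ge_max oppr_le0.
split=> [/andP[MA /(lambda0_ge0P symX) Xpsd]|[Xpsd MA]].
  by split=> //; move: MA; rewrite psd_prod_lambda.
by apply/andP; split; [rewrite psd_prod_lambda|exact/lambda0_ge0P].
Qed.

(** If [lambda X 0] is the term that makes the maximum nonnegative, it is [0];
then the determinant is [0] too and only [kappa x * curvature_weight p]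
remains. *)
Lemma convexified_ge0 x z p X : (0 < n)%N -> X^T = X -> 0 <= kappa x -> psd X ->
  0 <= convexified_MA_operator kappa x z p X
  <-> 0 <= MA_operator kappa x z p X.
Proof.
move=> n0 symX kx Xpsd.
rewrite /convexified_MA_operator psd_prod_lambda // le_max.
split=> [/orP[//|]|->//]; rewrite oppr_ge0 => l0.
rewrite /MA_operator det_lambda // (bigD1 (Ordinal n0)) //=.
have -> : lambda X 0 = 0 by apply/eqP; rewrite eq_le l0 lambda_ge0.
by rewrite mul0r oppr0 add0r mulr_ge0 // curvature_weight_ge0.
Qed.

End equivalence.

Theorem theorem3 (R : realType) (n : nat) (hn : (0 < n)%N)
  (Omega : set 'rV[R]_n) (Omega_nonempty : Omega !=set0)
  (Omega_open : open Omega) (Omega_bounded : bounded_set Omega)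
  (Omega_uconvex : uniformly_convex Omega)
  (kappa : 'rV[R]_n -> R)
  (kappa_ge0 : forall x, closure Omega x -> 0 <= kappa x)
  (kappa_continuous : {within closure Omega, continuous kappa})
  (kappa_bounded : [bounded kappa x | x in closure Omega])
  (u : 'rV[R]_n -> R) :
  convex_viscosity_solution (MA_operator kappa) Omega u
  <-> viscosity_solution (convexified_MA_operator kappa) Omega u.
Proof.
have kappa0 x : Omega x -> 0 <= kappa x.
  by move=> Ox; apply: kappa_ge0; exact: subset_closure.
have sym phi x (phiC2 : C2_on Omega phi) (Ox : Omega x) :=
  hessian_sym Omega_open phiC2 Ox.
split.
  move=> [/convex_functionP u_convex [[usc sub] [lsc super]]].
  split; split=> // phi phiC2 x Ox.
    move=> umax; apply/convexified_le0; first exact: sym.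
    split; last exact: sub.
    exact: (psd_hessian_of_touching Omega_open u_convex phiC2 Ox umax).
  move=> umin Xpsd.
  apply/convexified_ge0; [by []|exact: sym|exact: kappa0|by []|].
  exact: super.
move=> [[usc sub] [lsc super]].
have sub' phi x : C2_on Omega phi -> Omega x ->
    local_max_at Omega (fun y => u y - phi y) x ->
    psd (hessian phi x) /\
    MA_operator kappa x (u x) (gradient phi x) (hessian phi x) <= 0.
  move=> phiC2 Ox umax.
  by apply/convexified_le0; [exact: sym|exact: sub].
split; last first.
  split; split=> // phi phiC2 x Ox umm.
    by have [] := sub' _ _ phiC2 Ox umm.
  move=> Xpsd.
  by apply/convexified_ge0; [|exact: sym|exact: kappa0| |exact: super].
apply/convex_functionP => p e t Op Ope t01.
have [->|e0] := eqVneq e 0; first by rewrite scaler0 !addr0 subrr mulr0 addr0.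
have [Oconvex _] := Omega_uconvex.
apply: (segment_convexity Omega_open e0 _ _ _ Op Ope t01).
- by move=> *; exact: convex_set_segment.
- by move=> x Ox; exact: (semicontinuous_continuous Omega_open).
- by move=> phi x phiC2 Ox umax; have [] := sub' _ _ phiC2 Ox umax.
Qed.
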